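(* Let $\mathring{X}$ be a generalized labeled multi-Bernoulli random finite set on $\mathbb{X}\times\mathbb{L}$, i.e. with labeled multi-object density $$\mathring{f}(\mathring{X})=\Delta(\mathring{X})\sum_{\xi\in\Xi}w^{(\xi)}(\mathcal{L}(\mathring{X}))\prod_{(\mathbf{x},\ell)\in\mathring{X}}p^{(\xi)}(\mathbf{x},\ell),$$ where each $p^{(\xi)}(\cdot,\ell)$ is a probability density on $\mathbb{X}$, each weight $w^{(\xi)}(I)$, $I\in\mathcal{F}(\mathbb{L})$, is non-negative, and $\sum_{(I,\xi)\in\mathcal{F}(\mathbb{L})\times\Xi}w^{(\xi)}(I)=1$. Let $\mathcal{S}$ be a bounded field-of-view, and write $p^{(\xi,\ell)}(\mathbf{x})=p^{(\xi)}(\mathbf{x},\ell)$. Then the number of objects inside $\mathcal{S}$ is distributed according to the probability mass function $$\rho_{\mathcal{S}}(n)=\sum_{(\xi,\ \mathcal{I}_1\uplus\mathcal{I}_2)\in\Xi\times\mathcal{F}(\mathbb{L})}w^{(\xi)}(\mathcal{I}_1\uplus\mathcal{I}_2)\ \delta_n(|\mathcal{I}_1|)\ \prod_{\ell\in\mathcal{I}_1}\langle 1_{\mathcal{S}},p^{(\xi,\ell)}\rangle\ \prod_{\ell\in\mathcal{I}_2}\langle 1-1_{\mathcal{S}},p^{(\xi,\ell)}\rangle,$$ where the sum is over all $\xi\in\Xi$ and all ordered pairs $(\mathcal{I}_1,\mathcal{I}_2)$ of disjoint (possibly empty) finite subsets of $\mathbb{L}$.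
   Context: The single-object kinematic state space is $\mathbb{X}=\mathbb{X}_s\times\mathbb{X}_v\subseteq\mathbb{R}^{n_x}$, with $\mathbb{X}_s\subseteq\mathbb{R}^{n_s}$ (e.g. position space). A labeled state is $\mathring{x}=(\mathbf{x},\ell)\in\mathbb{X}\times\mathbb{L}$, with $\mathbb{L}$ a discrete (countable) label space. $\mathcal{F}(\mathbb{L})$ is the collection of finite subsets of $\mathbb{L}$, and $\Xi$ is a discrete (countable) index set (in tracking, histories of measurement association maps). $\mathcal{L}((\mathbf{x},\ell))=\ell$ and $\mathcal{L}(\mathring{X})=\{\mathcal{L}(\mathring{x}):\mathring{x}\in\mathring{X}\}$. The distinct label indicator is $\Delta(\mathring{X})=1$ if $|\mathcal{L}(\mathring{X})|=|\mathring{X}|$ and $0$ otherwise. $\delta_a(b)$ is the Kronecker delta. All functions are measurable, and empty products equal $1$. A field-of-view is a compact subset $\mathcal{S}$ of $\mathbb{X}_s$. For $\mathbf{x}\in\mathbb{X}$ with $\mathbb{X}_s$-component $\mathbf{s}$, $1_{\mathcal{S}}(\mathbf{x})=1$ if $\mathbf{s}\in\mathcal{S}$ and $0$ otherwise, and $1_{\mathcal{S}}((\mathbf{x},\ell))=1_{\mathcal{S}}(\mathbf{x})$. For integrable functions on $\mathbb{X}$, $\langle f,g\rangle=\int_{\mathbb{X}} f(\mathbf{x})g(\mathbf{x})\,\mathrm{d}\mathbf{x}$. The labeled set integral is $$\int g(\mathring{X})\,\delta\mathring{X}=\sum_{m=0}^{\infty}\frac{1}{m!}\sum_{(\ell_1,\dots,\ell_m)\in\mathbb{L}^m}\int_{\mathbb{X}^m}g(\{(\mathbf{x}_1,\ell_1),\dots,(\mathbf{x}_m,\ell_m)\})\,\mathrm{d}\mathbf{x}_1\cdots\mathrm{d}\mathbf{x}_m,$$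 the $m=0$ term being $g(\emptyset)$; in it, $\Delta$ vanishes on every tuple with a repeated label. The conditional probability that exactly $n$ objects lie inside the field-of-view given $\mathring{X}$ is $$\rho_{\mathcal{S}}(n\mid\mathring{X})=\sum_{\mathring{X}^n\subseteq\mathring{X},\ |\mathring{X}^n|=n}\ \prod_{\mathring{x}\in\mathring{X}^n}1_{\mathcal{S}}(\mathring{x})\prod_{\mathring{x}\in\mathring{X}\setminus\mathring{X}^n}(1-1_{\mathcal{S}}(\mathring{x})),$$ and the field-of-view cardinality distribution is $\rho_{\mathcal{S}}(n)=\int\rho_{\mathcal{S}}(n\mid\mathring{X})\,\mathring{f}(\mathring{X})\,\delta\mathring{X}$. *)

(* Defs.v *)
From HB Require Import structures.
From mathcomp Require Import all_boot all_order all_algebra finmap.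
From mathcomp Require Import all_classical all_reals all_analysis.

Set Implicit Arguments.
Unset Strict Implicit.
Unset Printing Implicit Defensive.
Import Order.TTheory GRing.Theory Num.Theory.
Import numFieldNormedType.Exports.

Local Open Scope classical_set_scope.
Local Open Scope ring_scope.

(* The library's product measure, under a name of its own on which its
   sigma-finiteness is inferred: for the library's constant, inference selects
   the instance for subprobabilities. *)
Section sigma_finite_product.
Context d1 d2 (T1 : measurableType d1) (T2 : measurableType d2) (R : realType).
Variables (m1 : {sigma_finite_measure set T1 -> \bar R})
          (m2 : {sigma_finite_measure set T2 -> \bar R}).

Definition prod_measure : set (T1 * T2) -> \bar R := (m1 \x m2)%E.

HB.instance Definition _ := Measure.on prod_measure.

Let prod_measure_sigma_finite : sigma_finite setT prod_measure.
Proof.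
have /sigma_finiteP[F [TF ndF Foo]] := sigma_finiteT m1.
have /sigma_finiteP[G [TG ndG Goo]] := sigma_finiteT m2.
exists (fun n => F n `*` G n).
  rewrite -setXTT TF TG predeqE => -[x y]; split.
    move=> [/= [n _ Fnx] [k _ Gky]]; exists (maxn n k) => //; split.
    - by move: x Fnx; exact/subsetPset/ndF/leq_maxl.
    - by move: y Gky; exact/subsetPset/ndG/leq_maxr.
  by move=> [n _ []/= ? ?]; split; exists n.
move=> k; have [? ?] := Foo k; have [? ?] := Goo k.
split; first exact: measurableX.
by rewrite /prod_measure product_measure1E// lte_mul_pinfty// ge0_fin_numE.
Qed.

HB.instance Definition _ := @Measure_isSigmaFinite.Build _ _ _ prod_measure
  prod_measure_sigma_finite.

End sigma_finite_product.

Section cons_measure.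
Context d (T : measurableType d) (R : realType) (n : nat).
Variables (mu : {sigma_finite_measure set T -> \bar R})
          (nu : {sigma_finite_measure set (n.-tuple T) -> \bar R}).

Definition cons_pair (x : T * n.-tuple T) : n.+1.-tuple T :=
  [tuple of x.1 :: x.2].

Lemma measurable_cons_pair : measurable_fun [set: T * n.-tuple T] cons_pair.
Proof. exact: measurable_cons. Qed.

Definition cons_measure : set (n.+1.-tuple T) -> \bar R :=
  pushforward (prod_measure mu nu) cons_pair.

Let cons_measure0 : cons_measure set0 = 0%E.
Proof. by rewrite /cons_measure /pushforward preimage_set0 measure0. Qed.

Let cons_measure_ge0 A : (0 <= cons_measure A)%E.
Proof. by rewrite /cons_measure /pushforward; exact: measure_ge0. Qed.

Let cons_measure_sigma_additive : semi_sigma_additive cons_measure.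
Proof.
move=> F mF tF mUF; rewrite /cons_measure /pushforward preimage_bigcup.
apply: measure_semi_sigma_additive.
- by move=> k; rewrite -[X in measurable X]setTI; exact: measurable_cons_pair.
- apply/trivIsetP => /= i j _ _ ij; rewrite -preimage_setI.
  by move/trivIsetP : tF => /(_ _ _ _ _ ij) ->//; rewrite preimage_set0.
- by rewrite -preimage_bigcup -[X in measurable X]setTI;
    exact: measurable_cons_pair.
Qed.

HB.instance Definition _ := isMeasure.Build _ _ _ cons_measure
  cons_measure0 cons_measure_ge0 cons_measure_sigma_additive.

Let cons_measure_sigma_finite : sigma_finite setT cons_measure.
Proof.
have [F FT Ffin] := sigma_finiteT (prod_measure mu nu).
pose g (t : n.+1.-tuple T) := (thead t, [tuple of behead t]).
have mg : measurable_fun setT g.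
  by apply/measurable_fun_pair; [exact: measurable_tnth|exact: measurable_behead].
have gK x : g (cons_pair x) = x.
  by case: x => x t; congr pair => //; exact: val_inj.
exists (fun i => g @^-1` F i).
  by rewrite -preimage_bigcup -FT preimage_setT.
move=> i; split.
  by rewrite -[X in measurable X]setTI; apply: mg => //; exact: (Ffin i).1.
rewrite /cons_measure /pushforward -comp_preimage.
rewrite (_ : g \o cons_pair = id) ?preimage_id; first exact: (Ffin i).2.
exact/funext.
Qed.

HB.instance Definition _ := @Measure_isSigmaFinite.Build _ _ _ cons_measure
  cons_measure_sigma_finite.

End cons_measure.

(* The n-fold product of mu, on n.-tuple T with the product sigma-algebra. *)
Fixpoint tuple_measure d (T : measurableType d) (R : realType)
    (mu : {sigma_finite_measure set T -> \bar R}) (n : nat) :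
    {sigma_finite_measure set (n.-tuple T) -> \bar R} :=
  if n is m.+1 then cons_measure mu (tuple_measure mu m)
  else (\d_([tuple] : 0.-tuple T)).

Section labeled_sets.
Context d (T : measurableType d) (R : realType) (L : countType).
Variables (mu : {sigma_finite_measure set T -> \bar R}) (D : set T).

Definition count_in (B : set (T * L)) (Y : {fset T * L}) : nat :=
  #|` [fset x in Y | x \in B]%fset|.

(* Generators of the sigma-algebra on finite sets: the events "Y has k points
   in B", with B measurable for the product of the sigma-algebra of T with the
   discrete one on L. *)
Definition counting_events : set (set {fset T * L}) :=
  [set E | exists (B : set (T * L)) (k : nat),
     (forall l, measurable [set x | B (x, l)]) /\
     E = [set Y | count_in B Y = k]].

Definition labeled_rfs_space := g_sigma_algebraType counting_events.

(* The set with elements (x_i, l_i); it has fewer than m of them when two of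
   these pairs coincide, which for Lebesgue measure in positive dimension is a
   null event. Any other tuple with a repeated label has distinct_labels 0. *)
Definition labeled_set m (x : m.-tuple T) (l : m.-tuple L) : {fset T * L} :=
  [fset (tnth x i, tnth l i) | i in 'I_m]%fset.

(* The sums are those of nonnegative extended reals, so this is the set
   integral of nonnegative functions g. *)
Definition set_integral (g : {fset T * L} -> \bar R) : \bar R :=
  (\sum_(0 <= m <oo) ((m`!)%:R^-1)%:E *
     \esum_(l in [set: m.-tuple L])
       \int[tuple_measure mu m]_(x in [set x | forall i, D (tnth x i)])
          g (labeled_set x l))%E.

Definition has_labeled_density d' (Om : measurableType d')
    (P : probability Om R) (X : {RV P >-> labeled_rfs_space})
    (f : {fset T * L} -> \bar R) : Prop :=
  forall E : set labeled_rfs_space, measurable E ->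
    distribution P X E = set_integral (fun Y => (\1_E Y)%:E * f Y)%E.

Definition labels (Y : {fset T * L}) : {fset L} := [fset x.2 | x in Y]%fset.

Definition distinct_labels (Y : {fset T * L}) : R :=
  (#|` labels Y| == #|` Y|)%:R.

(* The sum over xi may diverge at some points, hence the value in \bar R. *)
Definition glmb_density (Xi : countType) (w : Xi -> {fset L} -> R)
    (p : Xi -> T -> L -> R) (Y : {fset T * L}) : \bar R :=
  ((distinct_labels Y)%:E *
   \esum_(xi in [set: Xi])
     (w xi (labels Y) * \prod_(x <- Y) p xi x.1 x.2)%:E)%E.

Definition inner (f g : T -> R) : R := \int[mu]_(x in D) (f x * g x).

End labeled_sets.

Notation euclid R n := (n.-tuple (measurableTypeR R)).

Definition lebesgue_euclid (R : realType) (n : nat) :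
    {sigma_finite_measure set (euclid R n) -> \bar R} :=
  tuple_measure lebesgue_measure n.

(* Compactness in R^n, whose topology the library puts on row vectors. *)
Definition compact_euclid (R : realType) (n : nat) (S : set (euclid R n)) :=
  compact ((fun s : euclid R n => \row_i (tnth s i : R) : 'rV[R]_n) @` S).

(* R^(ns + nv), split into the coordinates of Xs and those of Xv. *)
Notation kinematic R ns nv := (euclid R ns * euclid R nv)%type.

Definition lebesgue_kinematic (R : realType) (ns nv : nat) :
    {sigma_finite_measure set (kinematic R ns nv) -> \bar R} :=
  prod_measure (lebesgue_euclid R ns) (lebesgue_euclid R nv).

Section field_of_view.
Context (R : realType) (ns nv : nat) (L : countType).
Variables (Xs : set (euclid R ns)) (Xv : set (euclid R nv)).
Variable S : set (euclid R ns).

Definition fov_indic (x : kinematic R ns nv) : R := \1_S x.1.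

Definition fov_count (Y : {fset kinematic R ns nv * L}) : nat :=
  count_in [set x | S x.1.1] Y.

Definition fov_cond_card (n : nat) (Y : {fset kinematic R ns nv * L}) : R :=
  \sum_(A <- fpowerset Y | #|` A| == n)
     ((\prod_(x <- A) fov_indic x.1) *
      (\prod_(x <- (Y `\` A)%fset) (1 - fov_indic x.1))).

Definition fov_card (f : {fset kinematic R ns nv * L} -> \bar R) (n : nat) :
    \bar R :=
  set_integral (lebesgue_kinematic R ns nv) (Xs `*` Xv)
    (fun Y => (fov_cond_card n Y)%:E * f Y)%E.

Definition fov_inner : (_ -> R) -> (_ -> R) -> R :=
  inner (lebesgue_kinematic R ns nv) (Xs `*` Xv).

End field_of_view.

(* Main.v *)
(* For a tuple l of distinct labels with set I, the event that n of the points
   x_i lie in B is the sum, over the splits of I into I1 and I2 with |I1| = n,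
   of the products of the indicators of B at the labels of I1 and of its
   complement at those of I2. By Tonelli the integral over x of each term of
   the density factorizes over I, and the m! orderings of I cancel the 1/m! of
   the set integral. Tuples with a repeated label only contribute on the event
   that two points coincide, which is null as Lebesgue measure in positive
   dimension is atomless in one of its coordinates. *)
Require Import Defs.
From HB Require Import structures.
From mathcomp Require Import all_boot all_order all_algebra finmap.
From mathcomp Require Import all_classical all_reals all_analysis measurable_realfun.
Import Order.TTheory GRing.Theory Num.Theory.
Import numFieldNormedType.Exports.
Local Open Scope classical_set_scope.
Local Open Scope ring_scope.

Set Implicit Arguments.
Unset Strict Implicit.
Unset Printing Implicit Defensive.

(** * Countable sums and integrals of nonnegative functions *)

(** Enumerating [J] by its codes brings results on series to sums over a countable type. A code that
    decodes to nothing, or outside [A], contributes the default 0. *)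
Lemma esum_pickle_inv (R : realType) (J : countType) (A : set J)
    (f : J -> \bar R) :
  (forall j, A j -> 0 <= f j)%E ->
  (\esum_(j in A) f j =
   \sum_(0 <= k <oo) oapp (f \_ A) 0 (pickle_inv k))%E.
Proof.
move=> f0.
have f0' j : (0 <= (f \_ A) j)%E by apply: erestrict_ge0.
rewrite nneseries_esumT; last by move=> k; case: pickle_inv => /=.
rewrite esum_mkcond.
rewrite (_ : \esum_(i in [set: nat]) _ = \esum_(k in choice.pickle @` [set: J])
    oapp (f \_ A) 0%E (pickle_inv k))%E; last first.
  rewrite [RHS]esum_mkcond; apply: eq_esum => k _.
  case: ifPn => //; rewrite notin_setE/=.
  case E : (pickle_inv k) => [j|]//= [].
  by exists j => //; have := @pickle_invK J k; rewrite E.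
rewrite esum_image; last by move=> i j _ _; exact: (pcan_inj pickleK_inv).
by apply: eq_esum => j _; rewrite pickleK_inv.
Qed.

(** Monotone convergence, applied to the series that enumerates [J]. *)
Lemma integral_esum d (T : measurableType d) (R : realType)
    (mu : {measure set T -> \bar R}) (J : countType) (A : set J)
    (f : J -> T -> \bar R) :
  (forall j, A j -> measurable_fun [set: T] (f j)) ->
  (forall j x, A j -> 0 <= f j x)%E ->
  (\int[mu]_x (\esum_(j in A) f j x) = \esum_(j in A) \int[mu]_x f j x)%E.
Proof.
move=> mf f0.
pose g k x := oapp (fun j => if j \in A then f j x else 0%E) 0%E (pickle_inv k).
transitivity (\int[mu]_x (\sum_(0 <= k <oo) g k x))%E.
  by apply: eq_integral => x _; rewrite esum_pickle_inv// => j /f0.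
rewrite integral_nneseries//.
- rewrite esum_pickle_inv; last first.
    by move=> j Aj; apply: integral_ge0 => x _; exact: f0.
  apply: eq_eseriesr => k _; rewrite /g.
  case: pickle_inv => [j|]/=; last by rewrite integral0.
  by rewrite patchE; case: ifP => // _; rewrite integral0.
- move=> k; rewrite /g; case: pickle_inv => [j|]/=; last exact: measurable_cst.
  by case jA : (j \in A); [exact/mf/set_mem|exact: measurable_cst].
- move=> k x _; rewrite /g; case: pickle_inv => [j|]//=.
  by case: ifPn => // /set_mem; exact: f0.
Qed.

Lemma esum_eq_term (R : realType) (J : choiceType) (A : set J) (f : J -> \bar R)
    (j0 : J) :
  A j0 -> (0 <= f j0)%E -> (forall j, A j -> j != j0 -> f j = 0%E) ->
  (\esum_(j in A) f j = f j0)%E.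
Proof.
move=> Aj0 f0 fA.
rewrite (esumID [set j0]); last first.
  by move=> j Aj; have [->//|/fA->] := eqVneq j j0.
rewrite (_ : A `&` [set j0] = [set j0]); last first.
  by apply/seteqP; split => [j []|j ->].
by rewrite esum_set1// esum1 ?adde0// => j [/fA fj /eqP /fj].
Qed.

(** No measurability is assumed: the integral of a nonnegative function is a supremum over the
    simple functions below it, and this family grows with the function. *)
Lemma ge0_le_integralT d (T : measurableType d) (R : realType)
    (mu : {measure set T -> \bar R}) (f g : T -> \bar R) :
  (forall x, 0 <= f x)%E -> (forall x, f x <= g x)%E ->
  (\int[mu]_x f x <= \int[mu]_x g x)%E.
Proof.
move=> f0 fg.
rewrite !ge0_integralTE//; last by move=> x; exact: le_trans (fg x).
apply: ereal_sup_le => _ [h hf <-]; exists h => // x.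
exact: le_trans (fg x).
Qed.

(** As [f] may fail to be measurable, it is compared with the constant [+oo] on [N], whose integral
    over a null set is 0. *)
Lemma integral_null_support d (T : measurableType d) (R : realType)
    (mu : {measure set T -> \bar R}) (N : set T) (f : T -> \bar R) :
  measurable N -> mu N = 0%E -> (forall x, 0 <= f x)%E ->
  (forall x, ~ N x -> f x = 0%E) -> (\int[mu]_x f x = 0)%E.
Proof.
move=> mN N0 f0 fN; apply/eqP; rewrite eq_le integral_ge0// andbT.
apply: (@le_trans _ _ (\int[mu]_(x in N) (cst +oo x))%E).
  rewrite [leRHS]integral_mkcond; apply: ge0_le_integralT => // x.
  by rewrite patchE; case: ifPn => [_|/negP xN]; rewrite ?leey// fN// => /mem_set.
by rewrite null_set_integral.
Qed.

(** * Integration against finite product measures *)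

Section tuple_measure.
Context d (T : measurableType d) (R : realType).
Variable mu : {sigma_finite_measure set T -> \bar R}.

Lemma integral_tuple_measureS m (f : m.+1.-tuple T -> \bar R) :
  measurable_fun setT f -> (forall x, 0 <= f x)%E ->
  (\int[tuple_measure mu m.+1]_z f z =
   \int[mu]_x \int[tuple_measure mu m]_t f [tuple of x :: t])%E.
Proof.
move=> mf f0.
rewrite [LHS](ge0_integral_pushforward (@measurable_cons_pair _ T m)
  (prod_measure mu (tuple_measure mu m)))// preimage_setT.
rewrite (fubini_tonelli1 (f \o @cons_pair _ T m))//.
  exact: measurableT_comp (@measurable_cons_pair _ T m).
by move=> x; exact: f0.
Qed.

Lemma tuple_measureSl m (A : set (m.+1.-tuple T)) : measurable A ->
  tuple_measure mu m.+1 A =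
  (\int[mu]_x tuple_measure mu m [set t : m.-tuple T | A [tuple of x :: t]])%E.
Proof.
move=> mA; apply: eq_integral => x _ /=; congr (tuple_measure mu m _).
by apply/seteqP; split => t; rewrite /xsection/= inE.
Qed.

(** The other order of integration: the tail is fixed and the head is measured. Both iterated
    integrals agree on rectangles, so uniqueness of the product measure applies. *)
Lemma tuple_measureSr m (A : set (m.+1.-tuple T)) : measurable A ->
  tuple_measure mu m.+1 A =
  (\int[tuple_measure mu m]_t mu [set x | A [tuple of x :: t]])%E.
Proof.
move=> mA.
have mA' : measurable (@cons_pair _ T m @^-1` A).
  by rewrite -[X in measurable X]setTI; exact: measurable_cons_pair.
transitivity ((mu \x^ tuple_measure mu m)%E (@cons_pair _ T m @^-1` A)).
  rewrite [LHS](@product_measure_unique _ _ _ _ _ mu (tuple_measure mu m)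
    (mu \x^ tuple_measure mu m)%E)// => B C mB mC.
  exact: product_measure2E.
apply: eq_integral => t _ /=; congr (mu _).
by apply/seteqP; split => x; rewrite /ysection/= inE.
Qed.

(** Induction on [m]: Tonelli isolates the head, whose factor leaves the inner integral. For [m = 0]
    the empty product is integrated against a Dirac mass. *)
Lemma integral_tuple_measure_prod m (f : 'I_m -> T -> R) (c : 'I_m -> R) :
  (forall i, measurable_fun setT (f i)) -> (forall i x, 0 <= f i x) ->
  (forall i, \int[mu]_x (f i x)%:E = (c i)%:E)%E ->
  (\int[tuple_measure mu m]_x (\prod_i f i (tnth x i))%:E = (\prod_i c i)%:E)%E.
Proof.
have mF k (g : 'I_k -> T -> R) : (forall i, measurable_fun setT (g i)) ->
    measurable_fun setT (fun x : k.-tuple T => (\prod_i g i (tnth x i))).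
  move=> mg; apply: measurable_prod => i _.
  exact: (measurableT_comp (mg i) (measurable_tnth i)).
elim: m f c => [|m IH] f c mf f0 fc.
  under eq_integral do rewrite big_ord0.
  by rewrite big_ord0 integral_cst// mul1e [LHS]diracT.
rewrite integral_tuple_measureS; last 2 first.
  - by apply/measurable_EFinP; exact: mF.
  - by move=> x; rewrite lee_fin prodr_ge0.
transitivity (\int[mu]_x ((\prod_i c (lift ord0 i))%:E * (f ord0 x)%:E))%E.
  apply: eq_integral => x _.
  transitivity (\int[tuple_measure mu m]_t
      ((f ord0 x)%:E * (\prod_i f (lift ord0 i) (tnth t i))%:E))%E.
    apply: eq_integral => t _; rewrite big_ord_recl EFinM tnth0.
    by congr (_ * _%:E)%E; apply: eq_bigr => i _; congr f; exact: tnthS.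
  rewrite ge0_integralZl_EFin//.
  - rewrite (IH (fun i => f (lift ord0 i)) (fun i => c (lift ord0 i)))//.
    by rewrite muleC.
  - by move=> t _; rewrite lee_fin prodr_ge0.
  - by apply/measurable_EFinP; exact: (mF _ (fun i => f (lift ord0 i))).
rewrite ge0_integralZl_EFin//.
- by rewrite fc -EFinM big_ord_recl mulrC.
- by move=> x _; rewrite lee_fin.
- exact/measurable_EFinP.
- rewrite prodr_ge0// => i _; rewrite -lee_fin -fc integral_ge0// => x _.
  by rewrite lee_fin.
Qed.

Lemma measurable_tnth_eq (a : T -> R) m (i j : 'I_m) :
  measurable_fun setT a ->
  measurable [set x : m.-tuple T | a (tnth x i) = a (tnth x j)].
Proof.
move=> ma.
have mai (k : 'I_m) : measurable_fun setT (fun x : m.-tuple T => a (tnth x k)).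
  exact: (measurableT_comp ma (measurable_tnth k)).
have := measurable_fun_eqr (mai i) (mai j).
move=> /(_ measurableT [set true]); rewrite setTI.
rewrite (_ : _ @^-1` _ = [set x : m.-tuple T | a (tnth x i) = a (tnth x j)]).
  exact.
by apply/seteqP; split => x /eqP.
Qed.

(** If neither index is 0, fixing the head leaves the same event on the tail, null by induction. If
    exactly one is 0, fixing the tail leaves a fibre of [a] for the head, null by hypothesis. *)
Lemma tuple_measure_tnth_eq (a : T -> R) m (i j : 'I_m) :
  measurable_fun setT a -> (forall r, mu (a @^-1` [set r]) = 0%E) ->
  i != j ->
  tuple_measure mu m [set x : m.-tuple T | a (tnth x i) = a (tnth x j)] = 0%E.
Proof.
move=> ma a0; elim: m i j => [[]//|m IH] i j.
case: (unliftP ord0 i) => [i'|] ->; case: (unliftP ord0 j) => [j'|] -> ij.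
- rewrite tuple_measureSl; last exact: measurable_tnth_eq.
  apply: integral0_eq => x _ /=; under eq_set do rewrite !(tnthS x).
  by apply: IH; apply: contra ij => /eqP ->.
- rewrite tuple_measureSr; last exact: measurable_tnth_eq.
  apply: integral0_eq => t _ /=.
  rewrite -[RHS](a0 (a (tnth t i'))).
  by congr (mu _); apply/seteqP; split => x; rewrite /= tnthS tnth0 => ->.
- rewrite tuple_measureSr; last exact: measurable_tnth_eq.
  apply: integral0_eq => t _ /=; rewrite -[RHS](a0 (a (tnth t j'))).
  by congr (mu _); apply/seteqP; split => x; rewrite /= tnthS tnth0 => ->.
- by rewrite eqxx in ij.
Qed.

End tuple_measure.

(** * Orderings of finite sets and sums over their subsets *)

Lemma iter_adde_ge0 (R : realType) (c : \bar R) k : (0 <= c)%E ->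
  (iter k (+%E c) 0 = k%:R%:E * c)%E.
Proof.
move=> c0; elim: k => [|k IH]; first by rewrite mul0e.
by rewrite iterS IH -natr1 EFinD ge0_muleDl// mul1e addeC.
Qed.

(** Grouping duplicate-free tuples by their set of entries: a set of [m] labels has [m!]
    orderings. *)
Lemma esum_uniq_tuple (R : realType) (L : countType) m (H : {fset L} -> \bar R) :
  (forall I, 0 <= H I)%E ->
  (\esum_(l in [set l : m.-tuple L | uniq l]) H [fset x in tval l]%fset =
   (m`!)%:R%:E * \esum_(I in [set I : {fset L} | #|` I| = m]) H I)%E.
Proof.
move=> H0.
pose J (I : {fset L}) := [set l : m.-tuple L | perm_eq l I].
transitivity (\esum_(I in [set I : {fset L} | #|` I| = m])
    \esum_(l in J I) H I)%E.
  rewrite (@esum_esum _ _ _ _ _ (fun I _ => H I))//.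
  (* The second projection is a bijection onto the duplicate-free tuples, since [I] is recovered as
     the set of entries of [l]. *)
  rewrite (@reindex_esum _ _ _
    ([set I : {fset L} | #|` I| = m] `*`` J) _ (fun k => k.2)).
    apply: eq_esum => -[I l] [/= _ lI]; congr H.
    by apply/fsetP => x; rewrite !inE (perm_mem lI).
  split => /=.
  - by move=> [I l] [/= _ lI]; rewrite (perm_uniq lI) fset_uniq.
  - move=> [I l] [I' l'] /set_mem[/= _ lI] /set_mem[/= _ lI'] /= ll'.
    rewrite -{}ll' in lI' *; congr pair; apply/fsetP => x.
    by rewrite -(perm_mem lI) (perm_mem lI').
  - move=> l ul; exists ([fset x in tval l]%fset, l) => //=.
    have lI : perm_eq l [fset x in tval l]%fset.
      by apply: uniq_perm => //= [|x]; rewrite ?fset_uniq// !inE.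
    by split => //=; rewrite -(perm_size lI) size_tuple.
transitivity (\esum_(I in [set I : {fset L} | #|` I| = m])
    \sum_(j < m`!) H I)%E; last first.
  by rewrite esum_sum// big_const_ord iter_adde_ge0// esum_ge0.
apply: eq_esum => I /= mI.
(* Every permutation of [I] has size [m], so [insub] discards none of them. *)
pose r : seq (m.-tuple L) := pmap insub (permutations I).
have vr : map val r = permutations I.
  rewrite /r pmap_filter; last exact: insubK.
  apply/all_filterP/allP => s; rewrite mem_permutations => sI.
  by rewrite insubT// (perm_size sI) mI.
have ur : uniq r by rewrite -(map_inj_uniq val_inj) vr permutations_uniq.
have -> : J I = [set` r].
  apply/seteqP; split => l; rewrite /J/= -mem_permutations -vr.
    by rewrite (mem_map val_inj).
  by rewrite (mem_map val_inj).
rewrite esum_fset//; last exact: finite_seq.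
rewrite -fsbig_seq// big_const_seq count_predT big_const_ord.
by rewrite -(size_map val) vr size_permutations// mI.
Qed.

Lemma prod_fsetU_disjoint (R : realType) (L : choiceType) (I1 I2 : {fset L})
    (f : L -> R) : [disjoint I1 & I2]%fset ->
  \prod_(l <- (I1 `|` I2)%fset) f l =
  (\prod_(l <- I1) f l) * (\prod_(l <- I2) f l).
Proof.
move=> dI; rewrite -big_cat; apply/perm_big/uniq_perm => //.
  rewrite cat_uniq !fset_uniq andbT/=; apply/hasPn => x xI2.
  by apply: contraL xI2 => xI1; move/fdisjointP : dI => /(_ _ xI1).
by move=> x; rewrite mem_cat in_fsetU.
Qed.

(** Only [A = E] survives: an element of [A] violating [e] kills the first product, and an element
    of [E] missing from [A] kills the second. *)
Lemma sum_fpowerset_indic (R : realType) (K : choiceType) (Y : {fset K})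
    (e : pred K) n :
  \sum_(A <- fpowerset Y | #|` A| == n)
    ((\prod_(x <- A) (e x)%:R) * (\prod_(x <- (Y `\` A)%fset) (1 - (e x)%:R))) =
  (#|` [fset x in Y | e x]%fset| == n)%:R :> R.
Proof.
set E := [fset x in Y | e x]%fset.
have EY : E \in fpowerset Y.
  by rewrite fpowersetE; apply/fsubsetP => x; rewrite !inE => /andP[].
have AE A : A \in fpowerset Y -> A != E ->
    (\prod_(x <- A) (e x)%:R) * (\prod_(x <- (Y `\` A)%fset) (1 - (e x)%:R)) = 0 :> R.
  rewrite fpowersetE => /fsubsetP AY.
  apply: contraNeq; rewrite mulf_eq0 negb_or !prodf_seq_neq0.
  move=> /andP[/allP h1 /allP h2].
  apply/eqP/fsetP => x; rewrite !inE/=.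
  apply/idP/andP => [xA|[xY ex]].
    by split; [exact: AY|move: (h1 _ xA); case: (e x) => //=; rewrite eqxx].
  apply: contraT => xA; move: (h2 x); rewrite in_fsetD xA xY => /(_ isT).
  by rewrite ex subrr eqxx.
rewrite big_mkcond (big_fsetD1 E)//= [X in _ + X]big1_seq ?addr0; last first.
  move=> A /=; rewrite !inE => /andP[AE' AY]; case: ifP => // _.
  exact: AE.
case: ifP => // _; rewrite !big1_seq ?mulr1// => x /=.
  by rewrite !inE => /andP[]; case: (x \in Y) => //= /negbTE ->; rewrite subr0.
by rewrite !inE => /andP[_ ->].
Qed.

(** * Finite sets built from a tuple of points and a tuple of labels *)

Section labeled_set_theory.
Context d (T : measurableType d) (R : realType) (L : countType).
Variables (m : nat) (x : m.-tuple T) (l : m.-tuple L).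

Lemma labels_labeled_set : labels (labeled_set x l) = [fset k in tval l]%fset.
Proof.
apply/fsetP => k; rewrite !inE/=.
apply/imfsetP/idP => [[y /imfsetP[i _ ->] ->]|].
  exact: mem_tnth.
move=> /tnthP[i ->]; exists (tnth x i, tnth l i) => //.
by apply/imfsetP; exists i.
Qed.

Hypothesis ul : uniq l.

Lemma labeled_set_snd_inj : {in labeled_set x l &, injective snd}.
Proof.
move=> _ _ /imfsetP[i _ ->] /imfsetP[j _ ->] /= lij.
by have -> : i = j by apply/(tuple_uniqP _ ul).
Qed.

Lemma distinct_labels_labeled_set : distinct_labels R (labeled_set x l) = 1.
Proof.
rewrite /distinct_labels /labels card_in_imfset ?eqxx//.
exact: labeled_set_snd_inj.
Qed.

Lemma big_labeled_set (f : T * L -> R) :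
  \prod_(y <- labeled_set x l) f y = \prod_i f (tnth x i, tnth l i).
Proof.
rewrite /labeled_set big_imfset /= ?big_enum//.
by move=> i j _ _ [_ lij]; apply/(tuple_uniqP _ ul).
Qed.

End labeled_set_theory.

Lemma prod_fset_tuple (R : realType) (L : countType) m (l : m.-tuple L)
    (f : L -> R) : uniq l ->
  \prod_(k <- [fset k in tval l]%fset) f k = \prod_i f (tnth l i).
Proof.
move=> ul; rewrite -(big_tuple _ _ l xpredT f); apply/perm_big/uniq_perm => [||k].
- exact: fset_uniq.
- exact: ul.
- by rewrite inE.
Qed.

(** * Distribution of the number of points in a measurable set [B] *)

Section glmb.
Context d (T : measurableType d) (R : realType) (L Xi : countType).
Variable mu : {sigma_finite_measure set T -> \bar R}.
Variables (D B : set T).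
Hypotheses (mD : measurable D) (mB : measurable B).
Variables (w : Xi -> {fset L} -> R) (p : Xi -> T -> L -> R).
Hypothesis w_ge0 : forall xi I, 0 <= w xi I.
Hypothesis mp : forall xi l, measurable_fun D (p xi ^~ l).
Hypothesis p_ge0 : forall xi l x, D x -> 0 <= p xi x l.
Hypothesis p_int1 : forall xi l, (\int[mu]_(x in D) (p xi x l)%:E = 1)%E.
(** A real coordinate with null fibres: two points that coincide share its value, which confines
    coincidences to a null event. *)
Variables (a : T -> R) (ma : measurable_fun setT a).
Hypothesis a_atomless : forall r, mu (a @^-1` [set r]) = 0%E.

Let Split := (Xi * ({fset L} * {fset L}))%type.
Implicit Types (t : Split).

Let side t (k : L) (x : T) : R := if k \in t.2.1 then \1_B x else 1 - \1_B x.

(** Vanishing outside [D] turns integrals over the box of tuples with entries in [D] into integrals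
    over all tuples, which factorize. *)
Let kern t (k : L) : T -> R := (fun x => side t k x * p t.1 x k) \_ D.

Definition glmb_split_weight n t : R :=
  w t.1 (t.2.1 `|` t.2.2)%fset * (n == #|` t.2.1|)%:R *
  (\prod_(l <- t.2.1) inner mu D \1_B (p t.1 ^~ l)) *
  (\prod_(l <- t.2.2) inner mu D (fun x => 1 - \1_B x) (p t.1 ^~ l)).

Let splits (I : {fset L}) : set Split :=
  [set t | [disjoint t.2.1 & t.2.2]%fset /\ (t.2.1 `|` t.2.2)%fset = I].

Let count_event n : set {fset T * L} :=
  [set Y | count_in [set y | B y.1] Y = n].

Let side01 t k x : 0 <= side t k x <= 1.
Proof.
rewrite /side indicE; case: ifP; case: (x \in B);
by rewrite ?subrr ?subr0 !lexx ler01.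
Qed.

Let mside t k : measurable_fun setT (side t k).
Proof.
have m1 : measurable_fun setT (\1_B : T -> R) by exact: measurable_indic.
rewrite /side; case: (k \in t.2.1) => //.
by apply: measurable_funB => //; exact: measurable_cst.
Qed.

Let mkern t k : measurable_fun setT (kern t k).
Proof.
apply/(measurable_restrictT _ mD)/measurable_funM => //.
exact: measurable_funTS.
Qed.

Let kern_ge0 t k x : 0 <= kern t k x.
Proof.
rewrite /kern patchE; case: ifP => // /set_mem Dx.
by rewrite mulr_ge0 ?p_ge0//; case/andP : (side01 t k x).
Qed.

Let inner_ge0 t k : 0 <= inner mu D (side t k) (p t.1 ^~ k).
Proof.
apply: Rintegral_ge0 => x Dx.
by rewrite mulr_ge0 ?p_ge0//; case/andP : (side01 t k x).
Qed.

(** [inner] is real-valued, so finiteness must be checked: [side] is at most 1 and the density has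
    mass 1. *)
Let integral_kern t k :
  (\int[mu]_x (kern t k x)%:E = (inner mu D (side t k) (p t.1 ^~ k))%:E)%E.
Proof.
rewrite /inner /Rintegral fineK.
  rewrite [RHS]integral_mkcond; apply: eq_integral => x _.
  by rewrite /kern !patchE; case: ifP.
have g0 x : D x -> (0 <= (side t k x * p t.1 x k)%:E)%E.
  by move=> Dx; rewrite lee_fin mulr_ge0 ?p_ge0//; case/andP : (side01 t k x).
rewrite ge0_fin_numE ?integral_ge0//.
apply: (@le_lt_trans _ _ 1%E); last by rewrite ltry.
rewrite -(p_int1 t.1 k); apply: ge0_le_integral => //.
- apply/measurable_EFinP/measurable_funM => //; exact: measurable_funTS.
- exact/measurable_EFinP.
- move=> x Dx; rewrite lee_fin -[leRHS]mul1r ler_wpM2r ?p_ge0//.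
  by case/andP : (side01 t k x).
Qed.

Let prod_inner t I : splits I t ->
  \prod_(k <- I) inner mu D (side t k) (p t.1 ^~ k) =
  (\prod_(l <- t.2.1) inner mu D \1_B (p t.1 ^~ l)) *
  (\prod_(l <- t.2.2) inner mu D (fun x => 1 - \1_B x) (p t.1 ^~ l)).
Proof.
move=> [dI <-]; rewrite prod_fsetU_disjoint//; congr (_ * _).
  by apply: eq_big_seq => k k1; rewrite /side k1.
apply: eq_big_seq => k k2; rewrite /side.
suff -> : (k \in t.2.1) = false by [].
by apply: contraTF k2 => k1; move/fdisjointP : dI => /(_ _ k1).
Qed.

Lemma glmb_split_weight_ge0 n t : [disjoint t.2.1 & t.2.2]%fset ->
  0 <= glmb_split_weight n t.
Proof.
move=> dt; rewrite /glmb_split_weight -mulrA.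
rewrite -(@prod_inner t (t.2.1 `|` t.2.2)%fset)//.
by rewrite mulr_ge0 ?mulr_ge0 ?ler0n// prodr_ge0.
Qed.

Let glmb_at n m (x : m.-tuple T) (l : m.-tuple L) : \bar R :=
  ((\1_(count_event n) (labeled_set x l))%:E *
   glmb_density w p (labeled_set x l))%E.

Let in_box m := [set x : m.-tuple T | forall i, D (tnth x i)].

(* The classes of a split of the labels must be those of the points inside and
   outside B for its product of indicators not to vanish at x. *)
Let glmb_at_uniq n m (x : m.-tuple T) (l : m.-tuple L) :
  uniq l -> @in_box m x ->
  (glmb_at n x l = \esum_(t in splits [fset k in tval l]%fset)
     (w t.1 [fset k in tval l]%fset * (n == #|` t.2.1|)%:R *
      \prod_i kern t (tnth l i) (tnth x i))%:E)%E.
Proof.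
move=> ul Dx.
set I := [fset k in tval l]%fset; set Y := labeled_set x l.
(* [I1] and [I2] hold the labels of the points inside and outside [B]: the one split that matches
   [x]. *)
pose Z := [fset y in Y | y \in [set y : T * L | B y.1]]%fset.
pose I1 := labels Z; pose I2 := (I `\` I1)%fset.
have ZY : {subset Z <= Y} by move=> y; rewrite !inE => /andP[].
have cI1 : #|` I1| = count_in [set y | B y.1] Y.
  rewrite /I1 /labels card_in_imfset// => y z /ZY yY /ZY zY.
  exact: (@labeled_set_snd_inj _ _ _ _ x l).
have lI1 i : (tnth l i \in I1) = (tnth x i \in B).
  apply/imfsetP/idP => [[y + lE]|xB].
    rewrite !inE/= => /andP[/imfsetP[j _ yE] yB].
    rewrite yE/= in lE; have -> : i = j by apply/(tuple_uniqP _ ul).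
    by move: yB; rewrite yE !inE.
  exists (tnth x i, tnth l i) => //; rewrite !inE/=; apply/andP; split.
    by apply/imfsetP; exists i.
  by move: xB; rewrite !inE.
have I1I : (I1 `<=` I)%fset.
  rewrite -[X in (_ `<=` X)%fset](labels_labeled_set x l).
  by apply/fsubsetP => k /imfsetP[y /ZY yY ->]; apply/imfsetP; exists y.
pose F xi (s : {fset L} * {fset L}) := (w xi I * (n == #|` s.1|)%:R *
      \prod_i kern (xi, s) (tnth l i) (tnth x i))%:E.
have F0 xi s : (0 <= F xi s)%E.
  by rewrite lee_fin mulr_ge0 ?mulr_ge0 ?ler0n// prodr_ge0.
pose S := [set s : {fset L} * {fset L} |
  [disjoint s.1 & s.2]%fset /\ (s.1 `|` s.2)%fset = I].
transitivity (\esum_(xi in [set: Xi]) F xi (I1, I2)); last first.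
  transitivity (\esum_(xi in [set: Xi]) \esum_(s in S) F xi s)%E; last first.
    rewrite esum_esum//.
    rewrite (_ : [set: Xi] `*`` _ = splits I).
      by apply: eq_esum => -[].
    by apply/seteqP; split => -[xi s] => [[]|].
  apply: eq_esum => xi _; apply/esym/esum_eq_term => //.
    split => /=; first by apply/fdisjointP => k k1; rewrite in_fsetD k1.
    by rewrite /I2 fsetUDl fsetDv fsetD0; exact/fsetUidPr.
  move=> s [ds sI] sI12.
  (* A split of [I] is determined by its first class, so one other than [(I1, I2)] misplaces the
     label of some point. *)
  have [i si] : exists i, (tnth l i \in s.1) != (tnth x i \in B).
    apply: contrapT => /forallNP h; move/eqP : sI12; apply.
    have s1I : (s.1 `<=` I)%fset by rewrite -sI fsubsetUl.
    have s1 : s.1 = I1.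
      apply/fsetP => k; have [/tnthP[i ->]|kl] := boolP (k \in tval l).
        by rewrite lI1; move/negP : (h i); rewrite negbK => /eqP.
      have kI : k \notin I by rewrite !inE.
      by rewrite (negbTE (contra (fsubsetP s1I k) kI))
         (negbTE (contra (fsubsetP I1I k) kI)).
    rewrite [s]surjective_pairing s1 /I2 -sI -s1 fsetDUl fsetDv fset0U.
    by congr pair; apply/esym/fsetDidPl; rewrite fdisjoint_sym.
  (* At the misplaced label, [side] is the indicator of a region that does not contain the point. *)
  rewrite /F (bigD1 i)//= [kern _ _ _](_ : _ = 0) ?mul0r ?mulr0//.
  rewrite /kern patchE (mem_set (Dx i)) /side/= indicE.
  by move: si; case: (_ \in s.1); case: (_ \in B) => //= _; rewrite ?subrr mul0r.
have FE xi : F xi (I1, I2) =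
    ((n == #|` I1|)%:R%:E * (w xi I * \prod_i p xi (tnth x i) (tnth l i))%:E)%E.
  rewrite /F -EFinM; congr EFin; rewrite mulrCA mulrA; congr (_ * _).
  apply: eq_bigr => i _; rewrite /kern patchE (mem_set (Dx i)) /side/= lI1 indicE.
  by case: (_ \in B); rewrite ?subr0 mul1r.
rewrite /glmb_at /glmb_density distinct_labels_labeled_set// mul1e.
rewrite labels_labeled_set -/I -/Y.
have -> : (\1_(count_event n) Y : R) = (n == #|` I1|)%:R.
  rewrite indicE cI1 /count_event; congr ((nat_of_bool _)%:R).
  by apply/idP/eqP => [/set_mem//|nE]; apply/mem_set.
under [RHS]eq_esum do rewrite FE.
case: (n == _); last by rewrite mul0e esum1// => xi _; rewrite mul0e.
rewrite mul1e; apply: eq_esum => xi _; rewrite mul1e.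
by rewrite (big_labeled_set x ul).
Qed.

(** The integrand is a sum over splits of products over coordinates: monotone convergence exchanges
    sum and integral, and each product then integrates factor by factor. *)
Let integral_glmb_uniq n m (l : m.-tuple L) : uniq l ->
  (\int[tuple_measure mu m]_(x in @in_box m) glmb_at n x l =
   \esum_(t in splits [fset k in tval l]%fset) (glmb_split_weight n t)%:E)%E.
Proof.
move=> ul; set I := [fset k in tval l]%fset.
pose G t (x : m.-tuple T) := ((w t.1 I * (n == #|` t.2.1|)%:R)%:E *
      (\prod_i kern t (tnth l i) (tnth x i))%:E)%E.
have mG t : measurable_fun setT
    (fun x : m.-tuple T => (\prod_i kern t (tnth l i) (tnth x i))%:E).
  apply/measurable_EFinP/measurable_prod => i _.
  exact: (measurableT_comp (mkern t _) (measurable_tnth i)).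
have G0 t : 0 <= w t.1 I * (n == #|` t.2.1|)%:R by rewrite mulr_ge0 ?ler0n.
rewrite integral_mkcond.
transitivity (\int[tuple_measure mu m]_x (\esum_(t in splits I) G t x))%E.
  apply: eq_integral => x _; rewrite patchE; case: ifPn => [/set_mem xD|xD].
    by rewrite glmb_at_uniq//; apply: eq_esum => t _; rewrite EFinM.
  (* Outside the box some point leaves [D], where its kernel vanishes, so every term is 0 as
     well. *)
  have [i xi] : exists i, ~ D (tnth x i).
    by apply/existsNP => xD'; move/negP : xD; apply; exact/mem_set.
  rewrite esum1// => t _; rewrite /G (bigD1 i)//= {1}/kern patchE memNset//.
  by rewrite mul0r mule0.
rewrite integral_esum; last 2 first.
- by move=> t _; apply: measurable_funeM; exact: mG.
- by move=> t x _; rewrite mule_ge0 ?lee_fin// prodr_ge0.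
apply: eq_esum => t tI.
rewrite ge0_integralZl_EFin//; last by move=> x _; rewrite lee_fin prodr_ge0.
rewrite (@integral_tuple_measure_prod _ _ _ _ _
  (fun i => kern t (tnth l i))
  (fun i => inner mu D (side t (tnth l i)) (p t.1 ^~ (tnth l i))))// -EFinM.
rewrite -(prod_fset_tuple (fun k => inner mu D (side t k) (p t.1 ^~ k)) ul).
by rewrite (prod_inner tI) mulrA /glmb_split_weight tI.2.
Qed.

Let glmb_at_ge0 n m (x : m.-tuple T) (l : m.-tuple L) : @in_box m x ->
  (0 <= glmb_at n x l)%E.
Proof.
move=> Dx; apply: mule_ge0; first by rewrite lee_fin indicE ler0n.
apply: mule_ge0; first by rewrite lee_fin ler0n.
apply: esum_ge0 => xi _; rewrite lee_fin mulr_ge0//.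
rewrite big_seq prodr_ge0// => y /imfsetP[i _ ->]; exact/p_ge0/Dx.
Qed.

(* A repeated label makes the distinct label indicator vanish, except on the
   null event where the two points carrying it coincide. *)
Let integral_glmb_not_uniq n m (l : m.-tuple L) : ~~ uniq l ->
  (\int[tuple_measure mu m]_(x in @in_box m) glmb_at n x l = 0)%E.
Proof.
move=> /tuple_uniqP nul.
have [i [j [lij ij]]] : exists i j, tnth l i = tnth l j /\ i != j.
  apply: contrapT => h; apply: nul => i j lij; apply: contrapT => /eqP ij.
  by apply: h; exists i, j.
rewrite integral_mkcond.
(* The null set used is the event that [a] agrees at [i] and [j]; it contains the coincidences and
   is measurable because [a] is. *)
apply: (integral_null_support (measurable_tnth_eq i j ma)).
- exact: tuple_measure_tnth_eq.
- by move=> x; apply: erestrict_ge0 => y; exact: glmb_at_ge0.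
- move=> x /= axij; rewrite patchE; case: ifP => // _.
  rewrite /glmb_at /glmb_density /distinct_labels.
  suff -> : (#|` labels (labeled_set x l)| == #|` labeled_set x l|) = false.
    by rewrite mul0e mule0.
  (* Equal cardinals would make the label injective on the set, so the two pairs with the same label
     would coincide and [a] would agree on them. *)
  apply/negP => /card_in_imfsetP inj; apply: axij.
  have xlY k : (tnth x k, tnth l k) \in labeled_set x l.
    by apply/imfsetP; exists k.
  by have [->] := inj _ _ (xlY i) (xlY j) lij.
Qed.

(** [H I] is the total contribution of the label set [I]. What remains is regrouping: by cardinal,
    then by label set, then by split. *)
Lemma glmb_count_distribution n :
  (set_integral mu D (fun Y => (\1_(count_event n) Y)%:E * glmb_density w p Y) =
   \esum_(t in [set t : Split | [disjoint t.2.1 & t.2.2]%fset])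
     (glmb_split_weight n t)%:E)%E.
Proof.
pose H I := (\esum_(t in splits I) (glmb_split_weight n t)%:E)%E.
have H0 I : (0 <= H I)%E.
  by apply: esum_ge0 => t [dt _]; rewrite lee_fin glmb_split_weight_ge0.
transitivity (\sum_(0 <= m <oo)
    \esum_(I in [set I : {fset L} | #|` I| = m]) H I)%E.
  apply: eq_eseriesr => m _.
  transitivity (((m`!)%:R^-1)%:E *
      \esum_(l in [set l : m.-tuple L | uniq l]) H [fset k in tval l]%fset)%E.
    congr (_ * _)%E; rewrite [RHS]esum_mkcond; apply: eq_esum => l _.
    case: ifPn => [/set_mem ul|]; first exact: integral_glmb_uniq.
    move=> /negP nul; apply: integral_glmb_not_uniq; apply/negP => ul.
    exact/nul/mem_set.
  have m0 : (m`!)%:R != 0 :> R by rewrite pnatr_eq0 -lt0n fact_gt0.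
  by rewrite esum_uniq_tuple// muleA -EFinM mulVf// mul1e.
rewrite nneseries_esumT; last by move=> m; exact: esum_ge0.
rewrite (@esum_esum _ _ _ _ _ (fun _ I => H I))//.
transitivity (\esum_(I in [set: {fset L}]) H I)%E.
  (* Each finite label set occurs for exactly one [m], its cardinal. *)
  rewrite (@reindex_esum _ _ _ [set: {fset L}] _ (fun I => (#|` I|, I)))//.
  split => //.
  - by move=> I J _ _ [].
  - by move=> [m I] /= [_ <-]; exists I.
rewrite /H esum_esum; last first.
  by move=> I t _ [dt _]; rewrite lee_fin glmb_split_weight_ge0.
(* Each disjoint pair splits exactly one label set, its union. *)
rewrite (@reindex_esum _ _ _ [set t : Split | [disjoint t.2.1 & t.2.2]%fset] _
  (fun t => ((t.2.1 `|` t.2.2)%fset, t)))//.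
split => //.
- by move=> t t' _ _ [].
- by move=> [I t] /= [_ [dt <-]]; exists t.
Qed.

End glmb.

(** * Compact sets, null hyperplanes and the field of view in Euclidean space *)

(* Open sets are unions of rational balls, which are boxes for the sup norm. *)
Lemma measurable_rV_open (R : realType) n (U : set 'rV[R]_n) : open U ->
  measurable ((fun s : euclid R n => \row_i (tnth s i : R) : 'rV[R]_n) @^-1` U).
Proof.
set f := (fun s : euclid R n => \row_i (tnth s i : R) : 'rV[R]_n) => oU.
(* Centres are rational and radii are inverses of positive integers. A ball not contained in [U] is
   replaced by the empty set, so that the union runs over a whole countable type. *)
pose c (q : n.-tuple rat * nat) : 'rV[R]_n := \row_i ratr (tnth q.1 i).
pose e (q : n.-tuple rat * nat) : R := q.2.+1%:R^-1.
pose V q :=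
  if pselect (ball (c q) (e q) `<=` U) then ball (c q) (e q) else set0.
have mball (y : 'rV[R]_n) r : 0 < r -> measurable (f @^-1` ball y r).
  move=> r0.
  rewrite (_ : _ @^-1` _ = \bigcap_(i in [set: 'I_n])
      ((fun s : euclid R n => tnth s i) @^-1` ball (y 0 i) r)).
    apply: fin_bigcap_measurable => // i _.
    rewrite -[X in measurable X]setTI; apply: measurable_tnth => //.
    exact: measurable_ball.
  apply/seteqP; split => s /=.
    by move=> [_ yr] i _ /=; have := yr 0 i; rewrite mxE.
  by move=> ys; split => // i j; rewrite ord1 mxE; exact: ys.
rewrite (_ : f @^-1` U = \bigcup_q (f @^-1` V q)).
  apply: countable_bigcupT_measurable => // q.
  rewrite /V; case: pselect => _ /=; last by rewrite preimage_set0.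
  by apply: mball; rewrite invr_gt0.
apply/seteqP; split => s /=; last first.
  by move=> [q _] /=; rewrite /V; case: pselect => //= qU; exact: qU.
move=> Us; have /nbhs_ballP[r /= r0 rU] : nbhs (f s) U.
  exact: open_nbhs_nbhs.
(* Below [r / 2], a ball of this radius containing [f s] stays within distance [r] of it, hence in
   [U]. *)
have [k kr] : exists k : nat, k.+1%:R^-1 < r / 2.
  have [k] := ltr_add_invr (divr_gt0 r0 (ltr0n R 2)).
  by rewrite add0r; exists k.
have e0 : 0 < k.+1%:R^-1 :> R by rewrite invr_gt0.
have [q qs] : exists q : n.-tuple rat, ball (c (q, k)) (e (q, k)) (f s).
  have /fin_all_exists[g gP] i : exists q : rat,
      ball (ratr q : R) k.+1%:R^-1 (tnth s i : R).
    have : tnth s i - k.+1%:R^-1 < tnth s i + k.+1%:R^-1 :> R.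
      by rewrite ltrBlDr -addrA ltrDl addr_gt0.
    move=> /rat_in_itvoo[q]; rewrite in_itv/= => qs; exists q.
    by rewrite /ball/= ltr_distl.
  exists [tuple g i | i < n]; split => // i j.
  by rewrite !mxE tnth_mktuple; exact: gP.
exists (q, k) => //=; rewrite /V; case: pselect => //= -[].
apply: subset_trans rU => z qz.
rewrite [r]splitr; apply: (ball_triangle (y := c (q, k))).
  by apply: ball_sym; apply: le_ball qs; exact: ltW.
by apply: le_ball qz; exact: ltW.
Qed.

(** The compact image is closed because row vectors form a Hausdorff space; as [f] is injective, the
    complement of [S] is the preimage of an open set. *)
Lemma compact_euclid_measurable (R : realType) n (S : set (euclid R n)) :
  compact_euclid S -> measurable S.
Proof.
set f := (fun s : euclid R n => \row_i (tnth s i : R) : 'rV[R]_n) => cS.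
have clS : closed (f @` S).
  exact: (compact_closed (@norm_hausdorff _ 'rV[R]_n)).
rewrite -[S]setCK; apply: measurableC.
rewrite (_ : ~` S = f @^-1` (~` (f @` S))).
  by apply: measurable_rV_open; exact: closed_openC.
apply/seteqP; split => s /= Ss.
  move=> [t St fts]; apply: Ss; rewrite (_ : s = t)//.
  apply: eq_from_tnth => i; move/rowP : fts => /(_ i); rewrite !mxE.
  by move=> ->.
by move=> ?; apply: Ss; exists s.
Qed.

(** The coordinate is the first one of the position if [ns] is positive, and of the other factor
    otherwise; its fibres are hyperplanes. *)
Lemma lebesgue_kinematic_atomless (R : realType) ns nv : (0 < ns + nv)%N ->
  exists2 a : kinematic R ns nv -> R, measurable_fun setT a &
    forall r, lebesgue_kinematic R ns nv (a @^-1` [set r]) = 0%E.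
Proof.
(* With the tail fixed, the slice of the hyperplane is a single point of the line. *)
have euclid0 n r : lebesgue_euclid R n.+1 (@thead n R @^-1` [set r]) = 0%E.
  rewrite [LHS]tuple_measureSr; last first.
    rewrite -[X in measurable X]setTI.
    exact: (@measurable_tnth _ (measurableTypeR R) _ ord0).
  apply: integral0_eq => t _ /=; rewrite -[RHS](lebesgue_measure_set1 r).
  by congr lebesgue_measure; apply/seteqP; split => x; rewrite /= theadE.
have mhead n r : measurable (@thead n R @^-1` [set r] : set (euclid R n.+1)).
  rewrite -[X in measurable X]setTI.
  exact: (@measurable_tnth _ (measurableTypeR R) _ ord0).
case: ns => [|ns] /= ns_gt0.
  case: nv ns_gt0 => // nv _; exists (fun x => thead x.2).
    exact: (measurableT_comp (measurable_tnth ord0)).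
  move=> r.
  rewrite (_ : _ @^-1` _ = setT `*` (@thead nv R @^-1` [set r])).
    transitivity (lebesgue_euclid R 0 setT *
        lebesgue_euclid R nv.+1 (@thead nv R @^-1` [set r]))%E.
      exact: (@product_measure1E _ _ _ _ _ (lebesgue_euclid R 0)
        (lebesgue_euclid R nv.+1) _ _ measurableT (mhead nv r)).
    by rewrite euclid0 mule0.
  by apply/seteqP; split => x //= [].
exists (fun x => thead x.1).
  exact: (measurableT_comp (measurable_tnth ord0)).
move=> r.
rewrite (_ : _ @^-1` _ = (@thead ns R @^-1` [set r]) `*` setT).
  (* The second factor may have infinite mass; in [\bar R] its product with 0 is still 0. *)
  transitivity (lebesgue_euclid R ns.+1 (@thead ns R @^-1` [set r]) *
      lebesgue_euclid R nv setT)%E; first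
    exact: (@product_measure1E _ _ _ _ _ (lebesgue_euclid R ns.+1)
      (lebesgue_euclid R nv) _ _ (mhead ns r) measurableT).
  by rewrite euclid0 mul0e.
by apply/seteqP; split => x //= [].
Qed.

(** Given [Y], the number of objects in [S] is determined, so its conditional distribution is a
    point mass. *)
Lemma fov_cond_cardE (R : realType) (ns nv : nat) (L : countType)
    (S : set (euclid R ns)) n (Y : {fset kinematic R ns nv * L}) :
  fov_cond_card S n Y = \1_[set Y' | fov_count S Y' = n] Y.
Proof.
rewrite /fov_cond_card /fov_indic indicE.
under eq_bigr => A _ do
  [under eq_bigr do rewrite indicE; under [X in _ * X]eq_bigr do rewrite indicE].
rewrite (sum_fpowerset_indic _ _ (fun x => x.1.1 \in S)).
congr ((nat_of_bool _)%:R).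
have -> : [fset x in Y | x.1.1 \in S]%fset =
    [fset x in Y | x \in [set x : kinematic R ns nv * L | S x.1.1]]%fset.
  by apply/fsetP => y; rewrite !inE/=; congr (_ && _).
by apply/eqP/idP => [cn|/set_mem//]; apply/mem_set.
Qed.

Unset Implicit Arguments.

Theorem proposition4 (R : realType) (ns nv : nat) (nx_gt0 : (0 < ns + nv)%N)
  (L Xi : countType)
  (Xs : set (euclid R ns)) (Xv : set (euclid R nv))
  (mXs : measurable Xs) (mXv : measurable Xv)
  (w : Xi -> {fset L} -> R) (p : Xi -> kinematic R ns nv -> L -> R)
  (w_ge0 : forall xi I, 0 <= w xi I)
  (w_sum1 : \esum_(t in [set: {fset L} * Xi]) (w t.2 t.1)%:E = 1%E)
  (mp : forall xi l, measurable_fun (Xs `*` Xv) (p xi ^~ l))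
  (p_ge0 : forall xi l x, (Xs `*` Xv) x -> 0 <= p xi x l)
  (p_int1 : forall xi l,
    (\int[lebesgue_kinematic R ns nv]_(x in Xs `*` Xv) (p xi x l)%:E)%E = 1%E)
  (d : measure_display) (Om : measurableType d) (P : probability Om R)
  (X : {RV P >-> labeled_rfs_space (kinematic R ns nv) L})
  (X_glmb : has_labeled_density (lebesgue_kinematic R ns nv) (Xs `*` Xv) X
              (glmb_density w p))
  (S : set (euclid R ns)) (S_sub : S `<=` Xs) (S_compact : compact_euclid S)
  (n : nat) :
  P [set om | fov_count S (X om) = n] =
    fov_card Xs Xv S (glmb_density w p) n /\
  fov_card Xs Xv S (glmb_density w p) n =
    \esum_(t in [set t : Xi * ({fset L} * {fset L}) |
                  [disjoint t.2.1 & t.2.2]%fset])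
      (w t.1 (t.2.1 `|` t.2.2)%fset * (n == #|` t.2.1|)%:R *
       (\prod_(l <- t.2.1) fov_inner Xs Xv (fov_indic S) (p t.1 ^~ l)) *
       (\prod_(l <- t.2.2)
          fov_inner Xs Xv (fun x => 1 - fov_indic S x) (p t.1 ^~ l)))%:E.
Proof.
set E : set {fset kinematic R ns nv * L} := [set Y | fov_count S Y = n].
have mS : measurable S := compact_euclid_measurable S_compact.
have mB : measurable [set x : kinematic R ns nv | S x.1].
  by rewrite -[X in measurable X]setTI; exact: measurable_fst.
have -> : fov_card Xs Xv S (glmb_density w p) n =
    set_integral (lebesgue_kinematic R ns nv) (Xs `*` Xv)
      (fun Y => (\1_E Y)%:E * glmb_density w p Y)%E.
  by congr set_integral; apply/funext => Y; rewrite fov_cond_cardE.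
split.
  (* [E] is one of the generating counting events, so the density hypothesis applies to it. *)
  have mE : measurable (E : set (labeled_rfs_space (kinematic R ns nv) L)).
    by apply: sub_sigma_algebra; exists [set x | S x.1.1], n; split.
  exact: (X_glmb _ mE).
have [a ma a0] := lebesgue_kinematic_atomless R nx_gt0.
exact: (glmb_count_distribution (measurableX mXs mXv) mB w_ge0 mp p_ge0 p_int1
  ma a0).
Qed.
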